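(* Let $A\in\mathbb{C}^{n\times n}$ be Hermitian, let $X^{(0)}\in\mathbb{C}^{n\times m_0}$ be an initial guess for the eigenvectors, let $V\in\mathbb{C}^{n\times m_0k}$ be the orthonormal basis ($V^HV=I$) of the block Krylov subspace $\mathcal{K}_k(A,X^{(0)})$ built by the block Arnoldi method, and let $H=V^HAV\in\mathbb{C}^{m_0k\times m_0k}$ be the corresponding upper Hessenberg matrix. Let $\mathcal{C}$ be a closed contour in the complex plane. Write the eigenvalue decomposition $H=X_V\Lambda X_V^H$ with $$X_V=[X_w\ \ X_u],\qquad \Lambda=\begin{pmatrix}\Lambda_w&0\\0&\Lambda_u\end{pmatrix},$$ where $(X_w,\Lambda_w)$ are the $m_0$ wanted Ritz eigenpairs (those whose eigenvalues are inside $\mathcal{C}$) and $(X_u,\Lambda_u)$ are the $(k-1)m_0$ unwanted ones, and write $X^{(0)}=VX_wW+VX_uU$, where $W$ and $U$ are the components of $X^{(0)}$ in terms of the wanted and unwanted Ritz vectors, respectively. Suppose that IFEAST is implemented with the Full Orthogonalization Method (FOM), so that the linear system $(zI-A)Y(z)=X^{(0)}$ is solved approximately by $$Y(z)=V\big(V^H(zI-A)V\big)^{-1}V^HX^{(0)}=V(zI-H)^{-1}V^HX^{(0)},$$ and let $Q=\frac{1}{2\pi i}\oint_{\mathcal{C}}Y(z)\,dz$. Then $$Q=V\frac{1}{2\pi i}\oint_{\mathcal{C}}(zI-H)^{-1}dz\,V^HX^{(0)}=V\rho(H)V^HX^{(0)}=V\big(X_w\rho(\Lambda_w)W+X_u\rho(\Lambda_u)U\big).$$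 That is, using FOM is equivalent to applying the FEAST filter function $\rho$ to the upper Hessenberg matrix $H$ from Arnoldi: the components of $X^{(0)}$ in the direction of the wanted Ritz vectors are kept roughly the same, and those in the direction of the unwanted Ritz vectors are substantially reduced. When the contour integral is evaluated exactly, $\rho(\Lambda_w)=I_{m_0\times m_0}$ and $\rho(\Lambda_u)=0_{(k-1)m_0\times(k-1)m_0}$, and IFEAST forms and solves a reduced eigenvalue problem using only the Arnoldi Ritz vectors corresponding to the wanted Ritz values. The vectors used as the initial guess for the next IFEAST iteration are then just the normalized Arnoldi Ritz vectors corresponding to the Ritz values inside $\mathcal{C}$, i.e. $$X^{(1)}=VX_w=VX_V\begin{pmatrix}I_{m_0\times m_0}\\0_{(k-1)m_0\times m_0}\end{pmatrix}.$$ Hence IFEAST with FOM is equivalent to performing block Arnoldi with a restart strategy that consists of selecting the desired Ritz vectors and discarding the rest.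
   Context: The superscript $H$ on a matrix denotes conjugate transpose (the letter $H$ alone is the matrix $V^HAV$). $\mathcal{K}_k(A,X)$ is the block Krylov subspace spanned by all columns of $X,AX,\dots,A^{k-1}X$. For a square matrix $M$, $\rho(M)=\frac{1}{2\pi i}\oint_{\mathcal{C}}(zI-M)^{-1}dz$, which in practice is approximated by a quadrature rule. The eigenvalues of $H$ are the Arnoldi Ritz values and the columns of $VX_V$ are the Arnoldi Ritz vectors. Explicitly restarted block Arnoldi replaces $X^{(0)}$ by a new starting block $X^{(1)}=VX_VM$, where $M\in\mathbb{C}^{m_0k\times m_0}$ gives the linear combinations of the estimated eigenvectors. FEAST forms $Q=\frac{1}{2\pi i}\oint_{\mathcal{C}}Y(z)\,dz$ from the solutions of $(zI-A)Y(z)=X^{(0)}$, solves the reduced eigenvalue problem $(Q^HAQ)X_Q=(Q^HQ)X_Q\Theta$ with $\Theta$ diagonal, and takes $X^{(1)}=QX_Q$ as the initial guess for the next iteration; IFEAST does the same with the linear systems solved approximately by an iterative method.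
   Formalization: The contour is taken counterclockwise with no Ritz value on it; that X^(1)=VX_w is an IFEAST output, and that each restart output is one, is stated only when Q^HQ is nonsingular (W invertible), since otherwise Q has rank below m_0 and the claim fails. *)

(* Defs.v *)
From mathcomp Require Import all_boot all_order all_algebra.
From mathcomp Require Import complex.
From mathcomp Require Import all_classical all_reals all_analysis.
Set Implicit Arguments.
Unset Strict Implicit.
Unset Printing Implicit Defensive.
Import Order.TTheory GRing.Theory Num.Theory.
Import numFieldNormedType.Exports.
Local Open Scope classical_set_scope.
Local Open Scope ring_scope.
Local Open Scope sesquilinear_scope.

(** * Closed contours *)

Definition C1 (R : realType) (u : R -> R) : Prop :=
  (forall t, derivable u t 1) /\ continuous (derive1 u).

(* A piecewise C^1 closed curve, as finitely many arcs parametrized by [0, 1],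
   each ending where the (cyclically) next one starts.  The arcs are C^1 on the
   whole line only to avoid one-sided derivatives: a C^1 function on [0, 1]
   always extends, and only the values on [0, 1] are ever used. *)
Record closed_contour (R : realType) := ClosedContour {
  narcs : nat;
  arc : 'I_narcs.+1 -> R -> R[i];
  arc_Re_C1 : forall l, C1 (fun t => complex.Re (arc l t));
  arc_Im_C1 : forall l, C1 (fun t => complex.Im (arc l t));
  arc_closed : forall l, arc l 1 = arc (ordS l) 0 }.

Definition darc (R : realType) (c : closed_contour R) (l : 'I_(narcs c).+1)
    (t : R) : R[i] :=
  Complex (derive1 (fun s => complex.Re (arc l s)) t)
          (derive1 (fun s => complex.Im (arc l s)) t).

(* [R[i]^o] is [R[i]] with its usual topology. *)
Definition trace (R : realType) (c : closed_contour R) : set R[i]^o :=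
  [set z | exists l (t : R), 0 <= t <= 1 /\ z = arc (c := c) l t].

Definition bounded_region (R : realType) (D : set R[i]^o) : Prop :=
  exists M : R, forall z : R[i], D z -> `|z| <= (M%:C)%C.

Definition inside (R : realType) (c : closed_contour R) (z : R[i]) : Prop :=
  ~ trace c z /\ bounded_region (connected_component (~` trace c) z).

Definition outside (R : realType) (c : closed_contour R) (z : R[i]) : Prop :=
  ~ trace c z /\ ~ bounded_region (connected_component (~` trace c) z).

(* The contour winds exactly once counterclockwise around [a]: the increments
   over the arcs of continuous determinations [theta l] of arg (z - a) add up
   to 2 pi. *)
Definition winds_once (R : realType) (c : closed_contour R) (a : R[i]) : Prop :=
  exists theta : 'I_(narcs c).+1 -> R -> R,
    [/\ forall l, {within `[0, 1], continuous (theta l)},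
        forall l (t : R), 0 <= t <= 1 ->
          arc l t - a = `|arc l t - a| * Complex (cos (theta l t)) (sin (theta l t))
      & \sum_l (theta l 1 - theta l 0) = 2 * pi].

(* For a simple closed curve this is the counterclockwise orientation. *)
Definition positively_oriented (R : realType) (c : closed_contour R) : Prop :=
  forall a : R[i], inside c a -> winds_once c a.

(** * Contour integrals and spectral filters *)

Definition cint (R : realType) (f : R -> R[i]) : R[i] :=
  Complex (\int[lebesgue_measure]_(t in `[0, 1]) complex.Re (f t))
          (\int[lebesgue_measure]_(t in `[0, 1]) complex.Im (f t)).

Definition oint (R : realType) (c : closed_contour R) (p q : nat)
    (F : R[i] -> 'M[R[i]]_(p, q)) : 'M[R[i]]_(p, q) :=
  \matrix_(i, j) \sum_l cint (fun t => F (arc l t) i j * darc (c := c) l t).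

Definition twopii (R : realType) : R[i] := Complex 0 (2 * pi).

Definition rho (R : realType) (c : closed_contour R) (p : nat)
    (M : 'M[R[i]]_p) : 'M[R[i]]_p :=
  (twopii R)^-1 *: oint c (fun z => invmx (z%:M - M)).

(* A quadrature rule for (2 pi i)^-1 times the contour integral, given by its
   (node, weight) pairs; the weights absorb the factor and dz/dt. *)
Definition quad (R : realType) (s : seq (R[i] * R[i])) (p q : nat)
    (F : R[i] -> 'M[R[i]]_(p, q)) : 'M[R[i]]_(p, q) :=
  \sum_(zw <- s) zw.2 *: F zw.1.

Definition rho_quad (R : realType) (s : seq (R[i] * R[i])) (p : nat)
    (M : 'M[R[i]]_p) : 'M[R[i]]_p :=
  quad s (fun z => invmx (z%:M - M)).

(** * Block Arnoldi *)

(* The block Krylov subspace as a row space: %MS subspaces are spanned by rows,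
   hence the (non-conjugate) transposes. *)
Definition krylov (R : realType) (n m0 : nat) (A : 'M[R[i]]_n)
    (X : 'M[R[i]]_(n, m0)) (k : nat) : 'M[R[i]]_n :=
  (\sum_(j < k) <<(A ^+ j *m X)^T>>)%MS.

(* [mxvec_index j a] is the index j * m0 + a of 'I_(k * m0). *)
Definition bcol (R : realType) (n k m0 : nat) (V : 'M[R[i]]_(n, k * m0))
    (j : 'I_k) : 'M[R[i]]_(n, m0) :=
  colsub (mxvec_index j) V.

(* [V] is an orthonormal basis of the block Krylov subspace satisfying the block
   Arnoldi recurrence.  The factors [S], usually upper triangular (QR), are left
   unrestricted: how each new block is orthonormalized does not matter. *)
Definition block_arnoldi (R : realType) (n k m0 : nat) (A : 'M[R[i]]_n)
    (X : 'M[R[i]]_(n, m0)) (V : 'M[R[i]]_(n, k * m0)) : Prop :=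
  [/\ V^t* *m V = 1%:M,
      (V^T == krylov A X k)%MS,
      forall j : 'I_k, j = 0%N :> nat -> exists S, X = bcol V j *m S
    & forall j j' : 'I_k, j' = j.+1 :> nat -> exists S,
        A *m bcol V j
          - \sum_(i < k | (i <= j)%N)
              bcol V i *m ((bcol V i)^t* *m A *m bcol V j)
        = bcol V j' *m S].

(* Upper Hessenberg by blocks of size m0. *)
Definition block_hessenberg (R : realType) (k m0 : nat)
    (H : 'M[R[i]]_(k * m0)) : Prop :=
  forall i j : 'I_k, (j.+1 < i)%N ->
  forall a b : 'I_m0, H (mxvec_index i a) (mxvec_index j b) = 0.

(* H = X_V Lambda X_V^H with X_V = [Xw Xu] unitary: the m0 Ritz values [lw] lie
   inside the contour, the (k - 1) m0 Ritz values [lu] outside. *)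
Definition ritz_decomposition (R : realType) (k m0 : nat)
    (c : closed_contour R) (H : 'M[R[i]]_(k * m0))
    (Xw : 'M[R[i]]_(k * m0, m0)) (lw : 'rV[R[i]]_m0)
    (Xu : 'M[R[i]]_(k * m0, k.-1 * m0)) (lu : 'rV[R[i]]_(k.-1 * m0)) : Prop :=
  let XV := row_mx Xw Xu in
  [/\ XV^t* *m XV = 1%:M /\ XV *m XV^t* = 1%:M,
      H = XV *m block_mx (diag_mx lw) 0 0 (diag_mx lu) *m XV^t*,
      forall j, inside c (lw 0 j)
    & forall j, outside c (lu 0 j)].

(* One explicit restart X1 = V X_V M that keeps the wanted Ritz vectors,
   M = [I; 0]; [th] lists the corresponding Ritz values.  The eigenvector
   matrix X_V is only determined up to the choice of an orthonormal eigenbasis,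
   hence the quantifier. *)
Definition arnoldi_restart (R : realType) (n k m0 : nat) (c : closed_contour R)
    (A : 'M[R[i]]_n) (V : 'M[R[i]]_(n, k * m0))
    (X1 : 'M[R[i]]_(n, m0)) (th : 'rV[R[i]]_m0) : Prop :=
  exists (Xw : 'M[R[i]]_(k * m0, m0)) (Xu : 'M[R[i]]_(k * m0, k.-1 * m0))
         (lu : 'rV[R[i]]_(k.-1 * m0)),
    ritz_decomposition c (V^t* *m A *m V) Xw th Xu lu /\
    X1 = V *m row_mx Xw Xu *m col_mx 1%:M 0.

(** * FEAST *)

(* The FOM approximation of the solution of (zI - A) Y = X. *)
Definition fom (R : realType) (n p m0 : nat) (A : 'M[R[i]]_n)
    (V : 'M[R[i]]_(n, p)) (X : 'M[R[i]]_(n, m0)) (z : R[i]) : 'M[R[i]]_(n, m0) :=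
  V *m invmx (V^t* *m (z%:M - A) *m V) *m V^t* *m X.

(* [X1] = Q X_Q for a solution of the reduced problem
   (Q^H A Q) X_Q = (Q^H Q) X_Q Theta, Theta = diag th, normalized as usual for a
   Hermitian definite pencil: X_Q^H (Q^H Q) X_Q = I. *)
Definition feast_iterate (R : realType) (n m0 : nat) (A : 'M[R[i]]_n)
    (Q : 'M[R[i]]_(n, m0)) (X1 : 'M[R[i]]_(n, m0)) (th : 'rV[R[i]]_m0) : Prop :=
  exists XQ : 'M[R[i]]_m0,
    [/\ (Q^t* *m A *m Q) *m XQ = (Q^t* *m Q) *m XQ *m diag_mx th,
        XQ^t* *m (Q^t* *m Q) *m XQ = 1%:M
      & X1 = Q *m XQ].

(* Main.v *)
Require Import Defs.
From mathcomp Require Import all_boot all_order all_algebra.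
From mathcomp Require Import complex ring lra.
From mathcomp Require Import all_classical all_reals all_analysis.
Set Implicit Arguments.
Unset Strict Implicit.
Unset Printing Implicit Defensive.
Import Order.TTheory GRing.Theory Num.Theory.
Import numFieldNormedType.Exports.
Local Open Scope ring_scope.
Local Open Scope sesquilinear_scope.

(** The FOM solution is V (zI - H)^-1 V^H X0, so integrating it only involves the
    resolvent of H.  In the Ritz basis this resolvent splits into the diagonal
    resolvents of Lw and Lu ([resolvent_split]); a linear operation on functions of z, be it a
    quadrature rule or the exact contour integral, therefore acts on Lw and Lu
    separately, and its effect on X0 = V Xw W + V Xu U is to filter the
    components W and U ([filter_components]).

    For the exact integral it remains to integrate dz / (z - a) along the contour.
    The real part is the differential of ln |z - a| and integrates to 0.  The
    imaginary part is the variation of the argument of z - a.  When a is inside,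
    orientation provides a continuous determination of this argument with total
    increment 2 pi, and such a determination is automatically a primitive
    ([winding_once]).  When a is outside, the integral is locally constant in a
    ([near_winding]), hence constant on the component of a, and it vanishes at a
    far point of this unbounded component ([winding_outside]).  All these
    steps rest on one explicit branch of the argument, the arctangent of
    [is_derive_arg].  So rho(Lw) = I, rho(Lu) = 0 and Q = V Xw W.

    The reduced problem then has matrices W^H Lw W and W^H W.  A normalized
    solution X_Q exists only if W is invertible, and then the solutions are the
    X_Q = W^-1 P with P unitary and Lw P = P Theta ([feast_rotation],
    [feast_of_rotation]), so the iterates are V Xw P.  The same
    matrices Xw P are exactly the possible orthonormal bases of wanted Ritz vectors
    ([restart_of_rotation], [restart_rotation]), since the Ritz values inside
    the contour are separated from those outside.  This identifies the two methods. *)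

(** * Primitives of the argument of a plane curve *)

(** The endpoints are treated separately because a primitive may be only continuous there:
    an arbitrary determination of the argument is such a primitive. *)
Lemma FTC01 (R : realType) (f F : R -> R) :
  (forall t : R, 0 <= t <= 1 -> {for t, continuous f}) ->
  {within `[0, 1], continuous F}%classic ->
  (forall t : R, 0 < t < 1 -> is_derive t 1 F (f t)) ->
  \int[lebesgue_measure]_(t in `[0, 1]) f t = F 1 - F 0.
Proof.
move=> cf cF dF; rewrite /Rintegral (@continuous_FTC2 _ f F)//.
- by apply: continuous_in_subspaceT => t /set_mem /=; rewrite in_itv; exact: cf.
- have /continuous_within_itvP [//|_ c0 c1] := cF.
  by split => // t; rewrite in_itv /= => /dF [].
- by move=> t; rewrite in_itv /= => /dF tF; rewrite derive1E; exact: derive_val.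
Qed.

(** For two plane curves z1 and z2 such that z1 * conj z2 has positive real part, this
    arctangent is the principal argument of z1 * conj z2, hence a C1 branch of
    arg z1 - arg z2; its derivative is Im (z1' / z1) - Im (z2' / z2). *)
Lemma is_derive_arg (R : realType) (x1 y1 x2 y2 : R -> R) (t u1 v1 u2 v2 : R) :
  is_derive t 1 x1 u1 -> is_derive t 1 y1 v1 ->
  is_derive t 1 x2 u2 -> is_derive t 1 y2 v2 ->
  0 < x1 t * x2 t + y1 t * y2 t ->
  is_derive t 1
    (fun s => atan ((y1 s * x2 s - x1 s * y2 s) / (x1 s * x2 s + y1 s * y2 s)))
    ((x1 t * v1 - y1 t * u1) / (x1 t ^+ 2 + y1 t ^+ 2)
     - (x2 t * v2 - y2 t * u2) / (x2 t ^+ 2 + y2 t ^+ 2)).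
Proof.
move=> dx1 dy1 dx2 dy2 pos.
pose d s := x1 s * x2 s + y1 s * y2 s.
pose q s := (y1 s * x2 s - x1 s * y2 s) * (d s)^-1.
have d0 : d t != 0 by rewrite gt_eqF.
have dd := is_deriveV d0 (is_deriveD (is_deriveM dx1 dx2) (is_deriveM dy1 dy2)).
have dn : is_derive t 1 (fun s => y1 s * x2 s - x1 s * y2 s) _ :=
  is_deriveB (is_deriveM dy1 dx2) (is_deriveM dx1 dy2).
have dq : is_derive t 1 q _ := is_deriveM dn dd.
apply: (@is_derive_eq _ _ _ (atan \o q) _ _ _ _
  (is_derive1_comp (is_derive1_atan (q t)) dq)).
have p1 : 0 < x1 t ^+ 2 + y1 t ^+ 2.
  rewrite lt_neqAle addr_ge0 ?sqr_ge0// andbT eq_sym paddr_eq0 ?sqr_ge0//.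
  rewrite !sqrf_eq0; apply/negP => /andP[/eqP a /eqP b].
  by move: pos; rewrite a b !mul0r addr0 ltxx.
have p2 : 0 < x2 t ^+ 2 + y2 t ^+ 2.
  rewrite lt_neqAle addr_ge0 ?sqr_ge0// andbT eq_sym paddr_eq0 ?sqr_ge0//.
  rewrite !sqrf_eq0; apply/negP => /andP[/eqP a /eqP b].
  by move: pos; rewrite a b !mulr0 addr0 ltxx.
rewrite /GRing.scale /= -/(d t).
have e : (x1 t ^+ 2 + y1 t ^+ 2) * (x2 t ^+ 2 + y2 t ^+ 2) =
  (y1 t * x2 t - x1 t * y2 t)^+2 + d t ^+ 2 by rewrite /d; ring.
have e2 : (1 + ((y1 t * x2 t - x1 t * y2 t) / d t) ^+ 2)^-1 =
  d t ^+ 2 / ((x1 t ^+ 2 + y1 t ^+ 2) * (x2 t ^+ 2 + y2 t ^+ 2)).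
  rewrite e; field.
  by rewrite d0/= -e mulf_neq0 // gt_eqF.
rewrite e2; move: d0 ; rewrite /d => d0; field.
by rewrite !gt_eqF.
Qed.

Lemma continuous_quotient_sqnorm (R : realType) (x y u v : R -> R) (t : R) :
  {for t, continuous x} -> {for t, continuous y} ->
  {for t, continuous u} -> {for t, continuous v} ->
  0 < x t ^+ 2 + y t ^+ 2 ->
  {for t, continuous (fun s => (x s * u s + y s * v s) / (x s ^+ 2 + y s ^+ 2))}.
Proof.
move=> cx cy cu cv p0.
apply: continuousM; first by apply: continuousD; exact: continuousM.
apply: continuousV; first by rewrite gt_eqF.
by apply: (continuousD (continuousM cx cx) (continuousM cy cy)).
Qed.

(** * The integrand dz / (z - a) along a contour *)

Section Contour.
Variables (R : realType) (c : closed_contour R).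
Implicit Types (a b z : R[i]) (l : 'I_(narcs c).+1) (t : R).
Local Notation arc := Defs.arc.
Local Notation Re := complex.Re.
Local Notation Im := complex.Im.

Definition sqnorm z : R := Re z ^+ 2 + Im z ^+ 2.

Lemma sqnorm_ge0 z : 0 <= sqnorm z.
Proof. by rewrite addr_ge0 ?sqr_ge0. Qed.

Lemma sqnorm_gt0 z : (0 < sqnorm z) = (z != 0).
Proof.
case: z => x y; rewrite lt_neqAle sqnorm_ge0 andbT eq_sym eq_complex /sqnorm /=.
by rewrite paddr_eq0 ?sqr_ge0// !sqrf_eq0.
Qed.

Lemma normc_sqnorm z : `|z| = ((Num.sqrt (sqnorm z))%:C)%C.
Proof. by rewrite normc_def. Qed.

Lemma is_derive_arc_Re l t : is_derive t 1 (fun s => Re (arc l s)) (Re (darc l t)).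
Proof.
have [dx _] := arc_Re_C1 l; split; first exact: dx.
by rewrite /= derive1E.
Qed.

Lemma is_derive_arc_Im l t : is_derive t 1 (fun s => Im (arc l s)) (Im (darc l t)).
Proof.
have [dx _] := arc_Im_C1 l; split; first exact: dx.
by rewrite /= derive1E.
Qed.

Lemma is_derive_subr_cst (f : R -> R) t u k :
  is_derive t 1 f u -> is_derive t 1 (fun s => f s - k) u.
Proof.
by move=> df; have := is_deriveB df (is_derive_cst k t 1); rewrite subr0.
Qed.

Lemma is_derive_continuous (f : R -> R) t u :
  is_derive t 1 f u -> {for t, continuous f}.
Proof. by case=> df _; exact/differentiable_continuous/derivable1_diffP. Qed.

Lemma Re_ratio a l t : Re ((arc l t - a)^-1 * darc l t) =
  ((Re (arc l t) - Re a) * Re (darc l t) + (Im (arc l t) - Im a) * Im (darc l t))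
  / ((Re (arc l t) - Re a) ^+ 2 + (Im (arc l t) - Im a) ^+ 2).
Proof. by case: (arc l t) => x y; case: a => a1 a2 /=; ring. Qed.

Lemma Im_ratio a l t : Im ((arc l t - a)^-1 * darc l t) =
  ((Re (arc l t) - Re a) * Im (darc l t) - (Im (arc l t) - Im a) * Re (darc l t))
  / ((Re (arc l t) - Re a) ^+ 2 + (Im (arc l t) - Im a) ^+ 2).
Proof. by case: (arc l t) => x y; case: a => a1 a2 /=; ring. Qed.

Lemma sqnorm_arc a l t : sqnorm (arc l t - a) =
  (Re (arc l t) - Re a) ^+ 2 + (Im (arc l t) - Im a) ^+ 2.
Proof. by case: (arc l t) => x y; case: a => a1 a2. Qed.

Lemma off_trace a l t : ~ trace c a -> 0 <= t <= 1 -> 0 < sqnorm (arc l t - a).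
Proof.
move=> na t01; rewrite sqnorm_gt0 subr_eq0; apply/eqP => e; apply: na.
by exists l, t.
Qed.

Lemma eq_is_derive (f g : R -> R) t u :
  f =1 g -> is_derive t 1 f u -> is_derive t 1 g u.
Proof. by move=> /funext ->. Qed.

Lemma eq_continuous_at (f g : R -> R) t :
  f =1 g -> {for t, continuous f} -> {for t, continuous g}.
Proof. by move=> /funext ->. Qed.

Lemma continuous_ratio a l t : ~ trace c a -> 0 <= t <= 1 ->
  {for t, continuous (fun s => Re ((arc l s - a)^-1 * darc l s))} /\
  {for t, continuous (fun s => Im ((arc l s - a)^-1 * darc l s))}.
Proof.
move=> na t01.
have cx := is_derive_continuous (is_derive_subr_cst (Re a) (is_derive_arc_Re l t)).
have cy := is_derive_continuous (is_derive_subr_cst (Im a) (is_derive_arc_Im l t)).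
have cu : {for t, continuous (fun s => Re (darc l s))}.
  by have [_ ] := arc_Re_C1 l; apply.
have cv : {for t, continuous (fun s => Im (darc l s))}.
  by have [_ ] := arc_Im_C1 l; apply.
have := off_trace l na t01; rewrite sqnorm_arc => p0; split.
  apply: eq_continuous_at (continuous_quotient_sqnorm cx cy cu cv p0) => s.
  by rewrite Re_ratio.
apply: eq_continuous_at (continuous_quotient_sqnorm cx cy cv (continuousN cu) p0) => s.
by rewrite Im_ratio mulrN.
Qed.

(** Each arc starts where the previous one ends, so a single-valued function has zero total
    increment along the contour. *)
Lemma telescope_arcs (G : R[i] -> R) :
  \sum_(l < (narcs c).+1) (G (arc l 1) - G (arc l 0)) = 0.
Proof.
rewrite sumrB; under eq_bigr do rewrite arc_closed.
by rewrite [X in _ - X](reindex_inj (@ordS_inj _)) subrr.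
Qed.

(** This is 2 pi times the winding number. *)
Definition winding a : R :=
  \sum_(l < (narcs c).+1)
    \int[lebesgue_measure]_(t in `[0, 1]) Im ((arc l t - a)^-1 * darc l t).

Lemma within_is_derive (F f : R -> R) :
  (forall t, 0 <= t <= 1 -> is_derive t 1 F (f t)) ->
  {within `[0, 1], continuous F}%classic.
Proof.
move=> dF; apply: continuous_in_subspaceT => t /set_mem /=; rewrite in_itv.
by move=> /dF; exact: is_derive_continuous.
Qed.

(** The real part of dz / (z - a) is the differential of the single-valued function
    ln |z - a|. *)
Lemma sum_Re_ratio a : ~ trace c a ->
  \sum_(l < (narcs c).+1)
    \int[lebesgue_measure]_(t in `[0, 1]) Re ((arc l t - a)^-1 * darc l t) = 0.
Proof.
move=> na; rewrite -[RHS](telescope_arcs (fun z => 2^-1 * ln (sqnorm (z - a)))).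
apply: eq_bigr => l _.
pose F t := 2^-1 * ln (sqnorm (arc l t - a)).
have dF t : 0 <= t <= 1 -> is_derive t 1 F (Re ((arc l t - a)^-1 * darc l t)).
  move=> t01; have p0 := off_trace l na t01.
  have dx := is_derive_subr_cst (Re a) (is_derive_arc_Re l t).
  have dy := is_derive_subr_cst (Im a) (is_derive_arc_Im l t).
  have dp : is_derive t 1 (fun s => sqnorm (arc l s - a)) _ :=
    eq_is_derive (fun s => esym (sqnorm_arc a l s))
      (is_deriveD (is_deriveM dx dx) (is_deriveM dy dy)).
  have dl := is_deriveZ 2^-1 (is_derive1_comp
    (g := fun s => sqnorm (arc l s - a)) (is_derive1_ln p0) dp).
  apply: (@is_derive_eq _ _ _ F _ _ _ _ dl).
  rewrite Re_ratio sqnorm_arc /GRing.scale /=.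
  by move: p0; rewrite sqnorm_arc => /lt0r_neq0 p0; field.
apply: (@FTC01 _ _ F).
- by move=> t t01; have [] := continuous_ratio l na t01.
- exact: within_is_derive dF.
- by move=> t /andP[t0 t1]; apply: dF; rewrite !ltW.
Qed.

End Contour.

(** * Winding integrals of nearby, far and enclosed points *)

Section Winding.
Variables (R : realType) (c : closed_contour R).
Implicit Types (a b z : R[i]) (l : 'I_(narcs c).+1) (t : R).
Local Notation arc := Defs.arc.
Local Notation Re := complex.Re.
Local Notation Im := complex.Im.

Lemma integrable01 (f : R -> R) :
  (forall t, 0 <= t <= 1 -> {for t, continuous f}) ->
  lebesgue_measure.-integrable `[0, 1] (EFin \o f).
Proof.
move=> cf; apply: continuous_compact_integrable; first exact: segment_compact.
by apply: continuous_in_subspaceT => t /set_mem /=; rewrite in_itv; exact: cf.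
Qed.

(** On the contour, (z - b) / (z - a) stays in the right half-plane, where the argument is
    single-valued; its increment is the difference of the two sides. *)
Lemma winding_near a b : ~ trace c a -> ~ trace c b ->
  (forall l t, 0 <= t <= 1 ->
    0 < (Re (arc l t) - Re b) * (Re (arc l t) - Re a)
        + (Im (arc l t) - Im b) * (Im (arc l t) - Im a)) ->
  winding c b = winding c a.
Proof.
move=> na nb pos; apply/eqP; rewrite -subr_eq0 -sumrB; apply/eqP.
pose G z := atan
  (((Im z - Im b) * (Re z - Re a) - (Re z - Re b) * (Im z - Im a)) /
   ((Re z - Re b) * (Re z - Re a) + (Im z - Im b) * (Im z - Im a))).
rewrite -[RHS](telescope_arcs c G); apply: eq_bigr => l _.
have ca t t01 := (continuous_ratio (t := t) l na t01).2.
have cb t t01 := (continuous_ratio (t := t) l nb t01).2.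
rewrite -RintegralB//; [|exact: integrable01..].
have dG t : 0 <= t <= 1 -> is_derive t 1 (fun s => G (arc l s))
    (Im ((arc l t - b)^-1 * darc l t) - Im ((arc l t - a)^-1 * darc l t)).
  move=> t01; rewrite !Im_ratio.
  have dxa := is_derive_subr_cst (Re a) (is_derive_arc_Re l t).
  have dya := is_derive_subr_cst (Im a) (is_derive_arc_Im l t).
  have dxb := is_derive_subr_cst (Re b) (is_derive_arc_Re l t).
  have dyb := is_derive_subr_cst (Im b) (is_derive_arc_Im l t).
  exact: (is_derive_arg dxb dyb dxa dya (pos l t t01)).
apply: (@FTC01 _ _ (fun t => G (arc l t))).
- by move=> t t01; apply: continuousB; [exact: cb|exact: ca].
- exact: within_is_derive dG.
- by move=> t /andP[t0 t1]; apply: dG; rewrite !ltW.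
Qed.

(** Here z - a stays in the open half-plane centred on the direction of -a, where the
    argument has a single-valued branch. *)
Lemma winding_far a : ~ trace c a ->
  (forall l t, 0 <= t <= 1 ->
    0 < (Re (arc l t) - Re a) * - Re a + (Im (arc l t) - Im a) * - Im a) ->
  winding c a = 0.
Proof.
move=> na pos.
pose G z := atan
  (((Im z - Im a) * - Re a - (Re z - Re a) * - Im a) /
   ((Re z - Re a) * - Re a + (Im z - Im a) * - Im a)).
rewrite -[RHS](telescope_arcs c G); apply: eq_bigr => l _.
have dG t : 0 <= t <= 1 -> is_derive t 1 (fun s => G (arc l s))
    (Im ((arc l t - a)^-1 * darc l t)).
  move=> t01; rewrite Im_ratio.
  have dx := is_derive_subr_cst (Re a) (is_derive_arc_Re l t).
  have dy := is_derive_subr_cst (Im a) (is_derive_arc_Im l t).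
  have := is_derive_arg dx dy (is_derive_cst (- Re a) t 1)
    (is_derive_cst (- Im a) t 1) (pos l t t01).
  by rewrite !mulr0 subrr mul0r subr0.
apply: (@FTC01 _ _ (fun t => G (arc l t))).
- by move=> t t01; exact: (continuous_ratio l na t01).2.
- exact: within_is_derive dG.
- by move=> t /andP[t0 t1]; apply: dG; rewrite !ltW.
Qed.

(** A continuous determination of the argument differs near each interior t from the smooth
    branch of is_derive_arg by a constant, so it is differentiable and the fundamental
    theorem of calculus computes the integral. *)
Lemma winding_once a : ~ trace c a -> winds_once c a -> winding c a = 2 * pi.
Proof.
move=> na [theta [ctheta arcE <-]]; apply: eq_bigr => l _.
apply: FTC01 => [t t01||t t01].
- exact: (continuous_ratio l na t01).2.
- exact: ctheta.
have t01' : 0 <= t <= 1 by case/andP: t01 => t0 t1; rewrite !ltW.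
pose r s := Num.sqrt (sqnorm (arc l s - a)).
have r0 s : 0 <= s <= 1 -> 0 < r s by move=> s01; rewrite sqrtr_gt0 off_trace.
have xyE s : 0 <= s <= 1 -> Re (arc l s) - Re a = r s * cos (theta l s) /\
                            Im (arc l s) - Im a = r s * sin (theta l s).
  move=> s01; have := arcE l s s01; rewrite normc_sqnorm -/(r s).
  case: (arc l s) => x y; case: (a) => a1 a2 /= => -[-> ->].
  by rewrite !mul0r subr0 addr0.
have dx := is_derive_subr_cst (Re a) (is_derive_arc_Re l t).
have dy := is_derive_subr_cst (Im a) (is_derive_arc_Im l t).
have dA := is_derive_arg dx dy (is_derive_cst (Re (arc l t) - Re a) t 1)
  (is_derive_cst (Im (arc l t) - Im a) t 1).
have {}dA := dA _.
rewrite !mulr0 subrr mul0r subr0 -Im_ratio in dA.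
have /dA {}dA : 0 < (Re (arc l t) - Re a) * (Re (arc l t) - Re a) +
    (Im (arc l t) - Im a) * (Im (arc l t) - Im a).
  by have := off_trace l na t01'; rewrite sqnorm_arc.
have := is_deriveD (is_derive_cst (theta l t) t 1) dA; rewrite add0r.
apply: near_eq_is_derive.
(* near t the increment of theta lies in the range where atan inverts tan *)
have ct : {for t, continuous (theta l)}.
  have /continuous_within_itvP [//|c01 _ _] := ctheta l.
  by apply: c01; rewrite in_itv.
near=> s; rewrite fctE /cst.
have s01 : 0 <= s <= 1.
  have : s \in `]0, 1[ by near: s; apply: near_in_itvoo; rewrite in_itv.
  by rewrite in_itv /= => /andP[s0 s1]; rewrite !ltW.
have sth : - (pi / 2) < theta l s - theta l t < pi / 2.
  rewrite -ltr_norml distrC; near: s.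
  by apply: (@cvgr_dist_lt _ _ _ _ _ _ _ ct); rewrite divr_gt0 ?pi_gt0.
have [-> ->] := xyE s s01; have [-> ->] := xyE t t01'.
have cs0 := cos_gt0_pihalf sth.
rewrite [X in atan X](_ : _ = tan (theta l s - theta l t)).
  by rewrite tanK ?in_itv//= addrC subrK.
move: cs0 (r0 s s01) (r0 t t01').
rewrite /tan sinB cosB => /lt0r_neq0 cs /lt0r_neq0 rs /lt0r_neq0 rt.
field; rewrite cs /=.
have -> : r s * cos (theta l s) * (r t * cos (theta l t)) +
  r s * sin (theta l s) * (r t * sin (theta l t)) =
  r s * r t * (cos (theta l s) * cos (theta l t) + sin (theta l s) * sin (theta l t)).
  by ring.
by rewrite !mulf_neq0.
Unshelve. all: by end_near. Qed.

End Winding.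

(** * Points outside the contour *)

Section Outside.
Local Open Scope classical_set_scope.
Local Open Scope ring_scope.
Variables (R : realType) (c : closed_contour R).
Implicit Types (a b z : R[i]) (l : 'I_(narcs c).+1) (t : R).
Local Notation arc := Defs.arc.
Local Notation Re := complex.Re.
Local Notation Im := complex.Im.

Lemma within_sqnorm_arc l a :
  {within `[0, 1], continuous (fun t => sqnorm (arc l t - a))}.
Proof.
apply: continuous_in_subspaceT => t _.
have cx := is_derive_continuous (is_derive_subr_cst (Re a) (is_derive_arc_Re l t)).
have cy := is_derive_continuous (is_derive_subr_cst (Im a) (is_derive_arc_Im l t)).
apply: eq_continuous_at (continuousD (continuousM cx cx) (continuousM cy cy)) => s.
by rewrite sqnorm_arc.
Qed.

Lemma trace_dist a : ~ trace c a ->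
  exists2 d : R, 0 < d & forall l t, 0 <= t <= 1 -> d <= sqnorm (arc l t - a).
Proof.
move=> na.
have dl l : exists d : R, 0 < d /\ forall t, 0 <= t <= 1 -> d <= sqnorm (arc l t - a).
  have [t0 t001 min] := EVT_min ler01 (@within_sqnorm_arc l a).
  exists (sqnorm (arc l t0 - a)); split.
    by apply: off_trace => //; rewrite in_itv in t001.
  by move=> t t01; apply: min; rewrite in_itv.
have [d dP] := choice dl.
exists (\big[Num.min/1]_l d l).
  by apply/bigmin_gtP; split => // l _; exact: (dP l).1.
move=> l t t01; apply: le_trans ((dP l).2 t t01); exact: bigmin_le_cond.
Qed.

Lemma trace_bounded :
  exists2 M : R, 0 <= M & forall l t, 0 <= t <= 1 -> sqnorm (arc l t) <= M ^+ 2.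
Proof.
have Ml l : exists M : R, forall t, 0 <= t <= 1 -> sqnorm (arc l t) <= M.
  have [t0 _ max] := EVT_max ler01 (@within_sqnorm_arc l 0).
  by exists (sqnorm (arc l t0 - 0)) => t t01; rewrite -(subr0 (arc l t)) max ?in_itv.
have [M MP] := choice Ml.
have S0 : 0 <= \sum_l `|M l| by apply: sumr_ge0.
(* the summand 1 makes the sum at most its square *)
exists (1 + \sum_l `|M l|); first exact: addr_ge0.
move=> l t t01; apply: (@le_trans _ _ (\sum_l `|M l|)).
  apply: le_trans (MP l t t01) _; rewrite (bigD1 l)//=.
  by apply: le_trans (ler_norm _) _; rewrite lerDl sumr_ge0.
by rewrite expr2 mulrDl mul1r mulrDr mulr1 -addrA addrCA lerDl !addr_ge0 ?mulr_ge0.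
Qed.

(** Expanding the square of the norm of (x - u, y - v) gives this form of the Cauchy-Schwarz
    inequality without square roots. *)
Lemma dot_lt (x y u v : R) : x ^+ 2 + y ^+ 2 < u ^+ 2 + v ^+ 2 ->
  x * u + y * v < u ^+ 2 + v ^+ 2.
Proof.
move=> h; have := sqr_ge0 (x - u); have := sqr_ge0 (y - v); nra.
Qed.

(** If b is closer to a than the contour is, then (z - b) / (z - a) lies in the disk of
    centre 1 and radius 1 for z on the contour. *)
Lemma near_winding a : ~ trace c a ->
  \forall b \near (a : R[i]^o), ~ trace c b /\ winding c b = winding c a.
Proof.
move=> na; have [d d0 dP] := trace_dist na.
have e0 : (0 : R[i]) < ((Num.sqrt d)%:C)%C by rewrite ltcR sqrtr_gt0.
apply/nbhs_ballP; exists ((Num.sqrt d)%:C)%C => // b.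
rewrite -ball_normE /= normc_sqnorm ltcR ltr_sqrt// => ab.
have nb : ~ trace c b.
  move=> [l [t [t01 bE]]]; have := dP l t t01; rewrite leNgt => /negP; apply.
  rewrite -bE; move: ab; rewrite /sqnorm.
  by case: (a) => a1 a2; case: (b) => b1 b2 /=; nra.
split=> //; apply: winding_near => // l t t01.
have /(lt_le_trans ab) := dP l t t01; rewrite sqnorm_arc => /= h.
have {}h : (Re b - Re a) ^+ 2 + (Im b - Im a) ^+ 2 <
  (Re (arc l t) - Re a) ^+ 2 + (Im (arc l t) - Im a) ^+ 2.
  apply: le_lt_trans h; case: (a) => a1 a2; case: (b) => b1 b2; rewrite /sqnorm /=; nra.
have := dot_lt h; nra.
Qed.

(** Off the contour the winding integral is locally constant, so its level sets are both
    open and closed. *)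
Lemma winding_component a b :
  connected_component (~` trace c) (a : R[i]^o) (b : R[i]^o) ->
  winding c b = winding c a.
Proof.
set C := connected_component _ _ => Cb.
have Csub : (C `<=` ~` trace c) by exact: connected_component_sub.
have na : ~ trace c a by case: Cb => D [Da Dsub _] _; exact: Dsub Da.
have opn (S : R -> Prop) : open ([set z | ~ trace c z /\ S (winding c z)] : set R[i]^o).
  rewrite openE => z [nz Sz]; rewrite /interior /=.
  have := near_winding nz; apply: filterS => w [nw wE].
  by split=> //; rewrite wE.
have CE : (C `&` [set z | winding c z = winding c a]) = C.
  apply: component_connected.
  - by exists a; split => //; exact: connected_component_refl.
  - exists [set z | ~ trace c z /\ winding c z = winding c a].
      exact: (opn (fun w => w = winding c a)).
    by apply/seteqP; split => z /= [Cz]; [move=> e; do 2?split => //; exact: Csub | case].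
  - exists (~` [set z | ~ trace c z /\ winding c z <> winding c a]).
      by rewrite closedC; exact: (opn (fun w => w <> winding c a)).
    apply/seteqP; split => z /= [Cz].
      by move=> e; split=> // -[_]; apply.
    move=> h; split => //; apply: contrapT => e; apply: h; split => //; exact: Csub.
by move: Cb; rewrite -CE => -[].
Qed.

(** An unbounded component contains a point outside a disk that covers the contour; the
    winding integral vanishes there. *)
Lemma winding_outside a : outside c a -> winding c a = 0.
Proof.
move=> [na nbd]; have [M M0 MP] := trace_bounded.
have [b Cb bM] : exists2 b : R[i],
    connected_component (~` trace c) (a : R[i]^o) b & M ^+ 2 < sqnorm b.
  apply: contrapT => h; apply: nbd; exists M => b Cb.
  rewrite normc_sqnorm lecR -(ger0_norm M0) -sqrtr_sqr ler_wsqrtr// leNgt.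
  by apply/negP => bM; apply: h; exists b.
rewrite -(winding_component Cb); apply: winding_far.
  exact: (connected_component_sub Cb).
move=> l t t01; have := le_lt_trans (MP l t t01) bM.
by move=> /dot_lt; nra.
Qed.

End Outside.

(** * Resolvents of diagonal matrices *)

Lemma scalar_sub_diag (K : fieldType) (n : nat) (z : K) (d : 'rV[K]_n) :
  z%:M - diag_mx d = diag_mx (\row_j (z - d 0 j)).
Proof. by apply/matrixP => i j; rewrite !mxE; case: eqP => _ //=; rewrite subr0. Qed.

Lemma unit_diag_sub (K : fieldType) (n : nat) (z : K) (d : 'rV[K]_n) :
  (z%:M - diag_mx d \in unitmx) = [forall j, z - d 0 j != 0].
Proof.
rewrite scalar_sub_diag unitmxE unitfE det_diag.
apply/prodf_neq0/forallP => h j; first by have := h j isT; rewrite !mxE.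
by move=> _; rewrite !mxE.
Qed.

Lemma invmx_diag_sub (K : fieldType) (n : nat) (z : K) (d : 'rV[K]_n) :
  (forall j, z - d 0 j != 0) ->
  invmx (z%:M - diag_mx d) = diag_mx (\row_j (z - d 0 j)^-1).
Proof.
move=> zd; have u : z%:M - diag_mx d \in unitmx by rewrite unit_diag_sub; exact/forallP.
rewrite -[RHS](mulKmx u) -[LHS]mulmx1; congr (_ *m _).
rewrite scalar_sub_diag mulmx_diag -diag_const_mx; congr diag_mx.
by apply/rowP => j; rewrite !mxE divff.
Qed.

(** * Linearity of contour integrals of matrices, and the exact filter *)

Section ContourIntegral.
Variables (R : realType).
Local Notation arc := Defs.arc.
Local Notation Re := complex.Re.
Local Notation Im := complex.Im.

Definition cintegrable (f : R -> R[i]) : Prop :=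
  lebesgue_measure.-integrable `[0, 1] (EFin \o (fun t => Re (f t))) /\
  lebesgue_measure.-integrable `[0, 1] (EFin \o (fun t => Im (f t))).

Lemma eq_cint (f g : R -> R[i]) :
  (forall t : R, 0 <= t <= 1 -> f t = g t) -> cint f = cint g.
Proof.
move=> fg; congr Complex; apply: eq_Rintegral => t;
  by move=> /set_mem /=; rewrite in_itv => /fg ->.
Qed.

Lemma eq_cintegrable (f g : R -> R[i]) :
  (forall t : R, 0 <= t <= 1 -> f t = g t) -> cintegrable f -> cintegrable g.
Proof.
move=> fg [fRe fIm]; split.
  by apply: eq_integrable fRe => // t /set_mem /=; rewrite in_itv => /fg ->.
by apply: eq_integrable fIm => // t /set_mem /=; rewrite in_itv => /fg ->.
Qed.

Lemma cintegrable0 : cintegrable (fun=> 0).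
Proof. by split; exact: integrable0. Qed.

Lemma cint0 : cint (fun=> 0 : R[i]) = 0.
Proof. by rewrite /cint /= !Rintegral_cst// !mul0r. Qed.

Lemma cintegrableD (f g : R -> R[i]) :
  cintegrable f -> cintegrable g -> cintegrable (fun t => f t + g t).
Proof.
move=> [f1 f2] [g1 g2]; split.
  apply: eq_integrable (integrableD _ f1 g1) => // t _ /=.
  by case: (f t); case: (g t).
apply: eq_integrable (integrableD _ f2 g2) => // t _ /=.
by case: (f t); case: (g t).
Qed.

Lemma cintD (f g : R -> R[i]) : cintegrable f -> cintegrable g ->
  cint (fun t => f t + g t) = cint f + cint g.
Proof.
move=> [f1 f2] [g1 g2]; rewrite /cint /=; congr Complex;
  rewrite -RintegralD//; apply: eq_Rintegral => t _;
  by case: (f t); case: (g t).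
Qed.

Lemma integrable_lincomb (u v : R -> R) (p q : R) :
  lebesgue_measure.-integrable `[0, 1] (EFin \o u) ->
  lebesgue_measure.-integrable `[0, 1] (EFin \o v) ->
  lebesgue_measure.-integrable `[0, 1] (EFin \o (fun t => p * u t + q * v t)).
Proof.
move=> iu iv; apply: eq_integrable (integrableD _ (integrableZl _ p iu)
  (integrableZl _ q iv)) => //.
Qed.

Lemma Rintegral_lincomb (u v : R -> R) (p q : R) :
  lebesgue_measure.-integrable `[0, 1] (EFin \o u) ->
  lebesgue_measure.-integrable `[0, 1] (EFin \o v) ->
  \int[lebesgue_measure]_(t in `[0, 1]) (p * u t + q * v t) =
  p * \int[lebesgue_measure]_(t in `[0, 1]) u t +
  q * \int[lebesgue_measure]_(t in `[0, 1]) v t.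
Proof.
move=> iu iv; rewrite -!RintegralZl// RintegralD//.
  by apply: eq_integrable (integrableZl _ p iu).
by apply: eq_integrable (integrableZl _ q iv).
Qed.

Lemma cintegrableZ (k : R[i]) (f : R -> R[i]) :
  cintegrable f -> cintegrable (fun t => k * f t).
Proof.
move=> [f1 f2]; case: k => p q; split.
  apply: eq_integrable (integrable_lincomb p (- q) f1 f2) => // t _ /=.
  by case: (f t) => x y /=; rewrite mulNr.
apply: eq_integrable (integrable_lincomb p q f2 f1) => // t _ /=.
by case: (f t) => x y /=.
Qed.

Lemma cintZ (k : R[i]) (f : R -> R[i]) :
  cintegrable f -> cint (fun t => k * f t) = k * cint f.
Proof.
move=> [f1 f2]; case: k => p q; rewrite /cint /=; congr Complex.
  rewrite -mulNr -Rintegral_lincomb//; apply: eq_Rintegral => t _ /=.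
  by case: (f t) => x y /=; rewrite mulNr.
rewrite -Rintegral_lincomb//; apply: eq_Rintegral => t _ /=.
by case: (f t).
Qed.

Lemma cint_sum (I : Type) (r : seq I) (w : I -> R[i]) (f : I -> R -> R[i]) :
  (forall i, cintegrable (f i)) ->
  cintegrable (fun t => \sum_(i <- r) w i * f i t) /\
  cint (fun t => \sum_(i <- r) w i * f i t) = \sum_(i <- r) w i * cint (f i).
Proof.
move=> fi; elim: r => [|i r [IH1 IH2]].
  split.
    by apply: eq_cintegrable cintegrable0 => t _; rewrite big_nil.
  by rewrite big_nil -[RHS]cint0; apply: eq_cint => t _; rewrite big_nil.
have wi := cintegrableZ (w i) (fi i); split.
  by apply: eq_cintegrable (cintegrableD wi IH1) => t _; rewrite big_cons.
rewrite big_cons -IH2 -cintZ// -cintD//.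
by apply: eq_cint => t _; rewrite big_cons.
Qed.

Variable c : closed_contour R.

Definition ointegrable (p q : nat) (F : R[i] -> 'M[R[i]]_(p, q)) : Prop :=
  forall (l : 'I_(narcs c).+1) i j,
    cintegrable (fun t => F (arc l t) i j * darc l t).

Lemma eq_oint (p q : nat) (F G : R[i] -> 'M[R[i]]_(p, q)) :
  (forall z, trace c z -> F z = G z) -> oint c F = oint c G.
Proof.
move=> FG; apply/matrixP => i j; rewrite !mxE; apply: eq_bigr => l _.
by apply: eq_cint => t t01; rewrite FG//; exists l, t.
Qed.

Lemma eq_ointegrable (p q : nat) (F G : R[i] -> 'M[R[i]]_(p, q)) :
  (forall z, trace c z -> F z = G z) -> ointegrable F -> ointegrable G.
Proof.
move=> FG iF l i j; apply: eq_cintegrable (iF l i j) => t t01.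
by rewrite FG//; exists l, t.
Qed.

Lemma ointegrableD (p q : nat) (F G : R[i] -> 'M[R[i]]_(p, q)) :
  ointegrable F -> ointegrable G -> ointegrable (fun z => F z + G z).
Proof.
move=> iF iG l i j; apply: eq_cintegrable (cintegrableD (iF l i j) (iG l i j)).
by move=> t _; rewrite mxE mulrDl.
Qed.

Lemma ointD (p q : nat) (F G : R[i] -> 'M[R[i]]_(p, q)) :
  ointegrable F -> ointegrable G ->
  oint c (fun z => F z + G z) = oint c F + oint c G.
Proof.
move=> iF iG; apply/matrixP => i j; rewrite !mxE -big_split /=; apply: eq_bigr => l _.
by rewrite -cintD//; apply: eq_cint => t _; rewrite mxE mulrDl.
Qed.

Lemma ointegrable_mull (p q r : nat) (B : 'M[R[i]]_(r, p))
    (F : R[i] -> 'M[R[i]]_(p, q)) :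
  ointegrable F -> ointegrable (fun z => B *m F z).
Proof.
move=> iF l i j; have [+ _] := cint_sum (index_enum 'I_p) (fun k => B i k)
  (fun k => iF l k j).
apply: eq_cintegrable => t _; rewrite mxE mulr_suml.
by apply: eq_bigr => k _; rewrite mulrA.
Qed.

Lemma oint_mull (p q r : nat) (B : 'M[R[i]]_(r, p)) (F : R[i] -> 'M[R[i]]_(p, q)) :
  ointegrable F -> oint c (fun z => B *m F z) = B *m oint c F.
Proof.
move=> iF; apply/matrixP => i j; rewrite !mxE.
under [RHS]eq_bigr do rewrite mxE mulr_sumr.
rewrite exchange_big; apply: eq_bigr => l _ /=.
have [_ <-] := cint_sum (index_enum 'I_p) (fun k => B i k) (fun k => iF l k j).
apply: eq_cint => t _; rewrite mxE mulr_suml.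
by apply: eq_bigr => k _; rewrite mulrA.
Qed.

Lemma ointegrable_mulr (p q r : nat) (F : R[i] -> 'M[R[i]]_(p, q))
    (B : 'M[R[i]]_(q, r)) :
  ointegrable F -> ointegrable (fun z => F z *m B).
Proof.
move=> iF l i j; have [+ _] := cint_sum (index_enum 'I_q) (fun k => B k j)
  (fun k => iF l i k).
apply: eq_cintegrable => t _; rewrite mxE mulr_suml.
by apply: eq_bigr => k _; rewrite mulrCA mulrA.
Qed.

Lemma oint_mulr (p q r : nat) (F : R[i] -> 'M[R[i]]_(p, q)) (B : 'M[R[i]]_(q, r)) :
  ointegrable F -> oint c (fun z => F z *m B) = oint c F *m B.
Proof.
move=> iF; apply/matrixP => i j; rewrite !mxE.
under [RHS]eq_bigr do rewrite mxE mulrC mulr_sumr.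
rewrite exchange_big; apply: eq_bigr => l _ /=.
have [_ <-] := cint_sum (index_enum 'I_q) (fun k => B k j) (fun k => iF l i k).
apply: eq_cint => t _; rewrite mxE mulr_suml.
by apply: eq_bigr => k _; rewrite mulrCA mulrA.
Qed.

Lemma trace_sub_neq0 (a z : R[i]) : ~ trace c a -> trace c z -> z - a != 0.
Proof. by move=> na tz; rewrite subr_eq0; apply/eqP => za; apply: na; rewrite -za. Qed.

Lemma ointegrable_resolvent_diag (p : nat) (d : 'rV[R[i]]_p) :
  (forall j, ~ trace c (d 0 j)) ->
  ointegrable (fun z => invmx (z%:M - diag_mx d)).
Proof.
move=> nd; apply: (@eq_ointegrable _ _ (fun z => diag_mx (\row_j (z - d 0 j)^-1))).
  by move=> z tz; rewrite invmx_diag_sub// => j; exact: trace_sub_neq0.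
move=> l i j; have [<-|ij] := eqVneq i j.
  have cr t t01 := continuous_ratio (t := t) l (nd i) t01.
  split; apply: integrable01 => t t01; have [c1 c2] := cr t t01.
    by apply: eq_continuous_at c1 => s; rewrite !mxE eqxx.
  by apply: eq_continuous_at c2 => s; rewrite !mxE eqxx.
by apply: eq_cintegrable cintegrable0 => t _; rewrite !mxE (negbTE ij) mul0r.
Qed.

(** The real parts of the entries vanish by sum_Re_ratio. *)
Lemma oint_resolvent_diag (p : nat) (d : 'rV[R[i]]_p) :
  (forall j, ~ trace c (d 0 j)) ->
  oint c (fun z => invmx (z%:M - diag_mx d)) =
  diag_mx (\row_j Complex 0 (winding c (d 0 j))).
Proof.
move=> nd; rewrite (@eq_oint _ _ _ (fun z => diag_mx (\row_j (z - d 0 j)^-1))).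
  apply/matrixP => i j; rewrite !mxE.
  have [<-|ij] := eqVneq i j; last first.
    rewrite big1 // => l _; rewrite -[RHS]cint0.
    by apply: eq_cint => t _; rewrite !mxE (negbTE ij) mul0r.
  have sumC (I : finType) (u v : I -> R) :
      \sum_i Complex (u i) (v i) = Complex (\sum_i u i) (\sum_i v i).
    by elim/big_ind3: _ => // x1 x2 x3 y1 y2 y3 -> ->.
  rewrite mulr1n -(sum_Re_ratio (nd i)) -sumC; apply: eq_bigr => l _.
  by apply: eq_cint => t _; rewrite !mxE eqxx.
by move=> z tz; rewrite invmx_diag_sub// => j; exact: trace_sub_neq0.
Qed.

Lemma twopii_neq0 : twopii R != 0.
Proof. by rewrite eq_complex /= eqxx /= mulf_neq0 // gt_eqF// pi_gt0. Qed.

Lemma rho_inside (p : nat) (d : 'rV[R[i]]_p) : positively_oriented c ->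
  (forall j, inside c (d 0 j)) -> rho c (diag_mx d) = 1%:M.
Proof.
move=> cpos din; rewrite /rho oint_resolvent_diag; last by move=> j; have [] := din j.
rewrite -diag_const_mx -linearZ /=; congr diag_mx; apply/rowP => j; rewrite !mxE.
rewrite winding_once; first by rewrite mulVf ?twopii_neq0.
- by have [] := din j.
- exact: cpos.
Qed.

Lemma rho_outside (p : nat) (d : 'rV[R[i]]_p) :
  (forall j, outside c (d 0 j)) -> rho c (diag_mx d) = 0.
Proof.
move=> dout; rewrite /rho oint_resolvent_diag; last by move=> j; have [] := dout j.
apply/matrixP => i j; rewrite !mxE winding_outside//.
by rewrite mul0rn mulr0.
Qed.

End ContourIntegral.

(** * Spectral splitting of the projected matrix *)

Section LinearAlgebra.
Variable C : numClosedFieldType.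

Lemma adjmxM (m n p : nat) (A : 'M[C]_(m, n)) (B : 'M[C]_(n, p)) :
  (A *m B)^t* = B^t* *m A^t*.
Proof. by rewrite trmx_mul map_mxM. Qed.

Lemma unitmx_gram (n : nat) (W : 'M[C]_n) : W^t* *m W \in unitmx -> W \in unitmx.
Proof. by rewrite unitmx_mul => /andP[]. Qed.

Section Splitting.
Variables (p q r : nat).
Variables (H : 'M[C]_p) (Xw : 'M[C]_(p, q)) (Xu : 'M[C]_(p, r)).
Variables (lw : 'rV[C]_q) (lu : 'rV[C]_r).
Hypothesis orthoV : (row_mx Xw Xu)^t* *m row_mx Xw Xu = 1%:M.
Hypothesis fullV : row_mx Xw Xu *m (row_mx Xw Xu)^t* = 1%:M.
Hypothesis HE : H = row_mx Xw Xu *m block_mx (diag_mx lw) 0 0 (diag_mx lu)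
  *m (row_mx Xw Xu)^t*.

Lemma ritz_orthonormal :
  [/\ Xw^t* *m Xw = 1%:M, Xw^t* *m Xu = 0, Xu^t* *m Xw = 0 & Xu^t* *m Xu = 1%:M].
Proof.
move: orthoV; rewrite tr_row_mx map_col_mx mul_col_row scalar_mx_block.
by move=> /eq_block_mx[].
Qed.

Lemma ritz_complete : Xw *m Xw^t* + Xu *m Xu^t* = 1%:M.
Proof. by rewrite -fullV tr_row_mx map_col_mx mul_row_col. Qed.

Lemma ritz_spectral :
  H = Xw *m diag_mx lw *m Xw^t* + Xu *m diag_mx lu *m Xu^t*.
Proof.
by rewrite HE mul_row_block !mulmx0 addr0 add0r tr_row_mx map_col_mx mul_row_col.
Qed.

Lemma ritz_vectorsw : H *m Xw = Xw *m diag_mx lw.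
Proof.
have [ww _ uw _] := ritz_orthonormal.
by rewrite ritz_spectral mulmxDl -!mulmxA ww uw !mulmx0 addr0 mulmx1.
Qed.

Lemma ritz_vectorsu : H *m Xu = Xu *m diag_mx lu.
Proof.
have [_ wu _ uu] := ritz_orthonormal.
by rewrite ritz_spectral mulmxDl -!mulmxA wu uu !mulmx0 add0r mulmx1.
Qed.

(** The right-hand side is a right inverse of zI - H, since zI - H maps Xw to Xw (zI - Lw)
    and Xu to Xu (zI - Lu). *)
Lemma resolvent_split (z : C) :
  z%:M - diag_mx lw \in unitmx -> z%:M - diag_mx lu \in unitmx ->
  invmx (z%:M - H) = Xw *m invmx (z%:M - diag_mx lw) *m Xw^t* +
                     Xu *m invmx (z%:M - diag_mx lu) *m Xu^t*.
Proof.
move=> uw uu; set G := RHS.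
have zX : (z%:M - H) *m Xw = Xw *m (z%:M - diag_mx lw) /\
          (z%:M - H) *m Xu = Xu *m (z%:M - diag_mx lu).
  rewrite (mulmxBl _ _ Xw) (mulmxBl _ _ Xu) (mulmxBr Xw) (mulmxBr Xu).
  by rewrite ritz_vectorsw ritz_vectorsu !mul_scalar_mx !mul_mx_scalar.
have e : (z%:M - H) *m G = 1%:M.
  rewrite mulmxDr !mulmxA zX.1 zX.2 -(mulmxA Xw) -(mulmxA Xu) !mulmxV// !mulmx1.
  exact: ritz_complete.
have [u _] := mulmx1_unit e.
by rewrite -[RHS]mul1mx -(mulVmx u) -mulmxA e mulmx1.
Qed.

Lemma resolvent_unit (z : C) : z%:M - H \in unitmx ->
  z%:M - diag_mx lw \in unitmx /\ z%:M - diag_mx lu \in unitmx.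
Proof.
have [ww _ _ uu] := ritz_orthonormal; move=> zH.
have ew : Xw^t* *m invmx (z%:M - H) *m Xw *m (z%:M - diag_mx lw) = 1%:M.
  rewrite -mulmxA mulmxBr mul_mx_scalar -ritz_vectorsw -mul_scalar_mx -mulmxBl.
  by rewrite -!mulmxA mulKmx.
have eu : Xu^t* *m invmx (z%:M - H) *m Xu *m (z%:M - diag_mx lu) = 1%:M.
  rewrite -mulmxA mulmxBr mul_mx_scalar -ritz_vectorsu -mul_scalar_mx -mulmxBl.
  by rewrite -!mulmxA mulKmx.
by have [_ ->] := mulmx1_unit ew; have [_ ->] := mulmx1_unit eu.
Qed.

(** By the separation hypothesis, the component of X along Xu intertwines two diagonal
    matrices without a common entry, hence is 0. *)
Lemma ritz_vectors_unique (X : 'M[C]_(p, q)) (th : 'rV[C]_q) :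
  H *m X = X *m diag_mx th -> (forall i j, lu 0 i != th 0 j) ->
  X = Xw *m (Xw^t* *m X).
Proof.
move=> HX sep; have [_ wu uw uu] := ritz_orthonormal.
suff uX : Xu^t* *m X = 0.
  by rewrite -[LHS]mul1mx -ritz_complete mulmxDl -!mulmxA uX mulmx0 addr0.
have e : diag_mx lu *m (Xu^t* *m X) = (Xu^t* *m X) *m diag_mx th.
  rewrite -mulmxA -HX ritz_spectral mulmxDl mulmxDr !mulmxA uw uu !mul0mx add0r.
  by rewrite mul1mx.
apply/matrixP => i j; move/matrixP/(_ i j): e.
rewrite mul_diag_mx mul_mx_diag !mxE => /eqP.
(* the entry (i, j) of the equation reads lu_i x = x th_j *)
rewrite [X in _ == X]mulrC -subr_eq0 -mulrBl mulf_eq0 subr_eq0 (negbTE (sep i j)).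
by move=> /eqP.
Qed.

End Splitting.

(** A nonzero entry P i j, which exists in each column j, forces th_j = l_i. *)
Lemma diag_similar_eigen (n : nat) (P : 'M[C]_n) (l th : 'rV[C]_n) :
  P \in unitmx -> diag_mx l *m P = P *m diag_mx th ->
  forall j, exists i, th 0 j = l 0 i.
Proof.
move=> uP e j; have : [exists i, P i j != 0].
  apply: contraLR uP => /existsPn P0.
  apply/negP => uP; have : col j P = 0.
    by apply/colP => i; rewrite !mxE; apply/eqP; rewrite -[_ == _]negbK P0.
  rewrite colE => /(congr1 (mulmx (invmx P))); rewrite mulKmx// mulmx0.
  by move=> /matrixP/(_ j 0)/eqP; rewrite !mxE !eqxx oner_eq0.
move=> /existsP[i Pij]; exists i; move/matrixP/(_ i j): e.
by rewrite mul_diag_mx mul_mx_diag !mxE mulrC => /(mulfI Pij).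
Qed.

End LinearAlgebra.

(** * Block Arnoldi and FOM *)

Section Arnoldi.
Variables (R : realType) (n k m0 : nat) (A : 'M[R[i]]_n) (X : 'M[R[i]]_(n, m0)).
Variable V : 'M[R[i]]_(n, k * m0).
Hypothesis VA : block_arnoldi A X V.

Lemma mxvec_index_inj (m p : nat) (i i' : 'I_m) (a a' : 'I_p) :
  mxvec_index i a = mxvec_index i' a' -> i = i' /\ a = a'.
Proof. by move/cast_ord_inj/enum_rank_inj => [-> ->]. Qed.

Lemma bcol_adjM (i j : 'I_k) (M : 'M[R[i]]_n) (a b : 'I_m0) :
  ((bcol V i)^t* *m M *m bcol V j) a b =
  (V^t* *m M *m V) (mxvec_index i a) (mxvec_index j b).
Proof.
rewrite !mxE; apply: eq_bigr => x _; rewrite !mxE; congr (_ * _).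
by apply: eq_bigr => y _; rewrite !mxE.
Qed.

Lemma bcol_orthogonal (i j : 'I_k) : i != j -> (bcol V i)^t* *m bcol V j = 0.
Proof.
have [VV _ _ _] := VA; move=> ij; apply/matrixP => a b.
have := bcol_adjM i j 1%:M a b; rewrite !mulmx1 VV => ->; rewrite !mxE.
by case: eqP => // /mxvec_index_inj[/eqP]; rewrite (negbTE ij).
Qed.

(** By the recurrence, A maps block j into the span of the blocks up to j + 1, and distinct
    blocks are orthogonal. *)
Lemma arnoldi_hessenberg : block_hessenberg (V^t* *m A *m V).
Proof.
have [_ _ _ rec] := VA; move=> i j ji a b.
pose j' := Ordinal (ltn_trans ji (ltn_ord i)).
have [S] := rec j j' erefl; move=> /eqP; rewrite subr_eq => /eqP e.
rewrite -bcol_adjM -mulmxA e mulmxDr mulmxA bcol_orthogonal; last first.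
  by apply/eqP => ij; move: (ji); rewrite ij /= ltnn.
rewrite mul0mx add0r mulmx_sumr big1 ?mxE// => i' i'j.
rewrite mulmxA bcol_orthogonal ?mul0mx//.
by apply/eqP => ii'; move: (ji); rewrite ii' ltnNge ltnW// ltnS.
Qed.

Lemma arnoldi_start : (0 < k)%N -> V *m (V^t* *m X) = X.
Proof.
have [VV _ st _] := VA; move=> k0; have [S ->] := st (Ordinal k0) erefl.
suff e : V *m V^t* *m bcol V (Ordinal k0) = bcol V (Ordinal k0).
  by rewrite mulmxA mulmxA e.
have -> : bcol V (Ordinal k0) = V *m colsub (mxvec_index (Ordinal k0)) 1%:M.
  rewrite -[in LHS](mulmx1 V); apply/matrixP => x y; rewrite !mxE.
  by apply: eq_bigr => z _; rewrite !mxE.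
by rewrite -mulmxA (mulmxA (V^t*)) VV mul1mx.
Qed.

Lemma fom_resolvent z : fom A V X z =
  V *m invmx (z%:M - V^t* *m A *m V) *m V^t* *m X.
Proof.
have [VV _ _ _] := VA.
by rewrite /fom mulmxBr mulmxBl mul_mx_scalar -scalemxAl VV scalemx1.
Qed.

End Arnoldi.

(** * Filters applied to the projected matrix *)

Section Filters.
Variables (R : realType) (k m0 : nat) (c : closed_contour R).

Lemma quad_mul (p q r s : nat) (e : seq (R[i] * R[i])) (B : 'M[R[i]]_(r, p))
    (F : R[i] -> 'M[R[i]]_(p, q)) (D : 'M[R[i]]_(q, s)) :
  quad e (fun z => B *m F z *m D) = B *m quad e F *m D.
Proof.
rewrite /quad mulmx_sumr mulmx_suml; apply: eq_bigr => zw _.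
by rewrite -scalemxAr -scalemxAl.
Qed.

Lemma quadD (p q : nat) (e : seq (R[i] * R[i])) (F G : R[i] -> 'M[R[i]]_(p, q)) :
  quad e (fun z => F z + G z) = quad e F + quad e G.
Proof.
by rewrite /quad -big_split; apply: eq_bigr => zw _; rewrite scalerDr.
Qed.

Lemma eq_quad (p q : nat) (e : seq (R[i] * R[i])) (F G : R[i] -> 'M[R[i]]_(p, q)) :
  {in e, forall zw, F zw.1 = G zw.1} -> quad e F = quad e G.
Proof.
by move=> FG; apply: eq_big_seq => zw ze; rewrite FG.
Qed.

Lemma rho_quad_diag (p : nat) (e : seq (R[i] * R[i])) (d : 'rV[R[i]]_p) :
  {in e, forall zw, zw.1%:M - diag_mx d \in unitmx} ->
  rho_quad e (diag_mx d) =
  diag_mx (\row_j \sum_(zw <- e) zw.2 * (zw.1 - d 0 j)^-1).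
Proof.
move=> ue; rewrite /rho_quad (@eq_quad _ _ _ _
  (fun z => diag_mx (\row_j (z - d 0 j)^-1))).
  apply/matrixP => i j; rewrite /quad summxE !mxE -sumrMnl.
  by apply: eq_bigr => zw _; rewrite !mxE mulrnAr.
by move=> zw /ue; rewrite unit_diag_sub => /forallP; exact: invmx_diag_sub.
Qed.

Variables (H : 'M[R[i]]_(k * m0)).
Variables (Xw : 'M[R[i]]_(k * m0, m0)) (lw : 'rV[R[i]]_m0).
Variables (Xu : 'M[R[i]]_(k * m0, k.-1 * m0)) (lu : 'rV[R[i]]_(k.-1 * m0)).
Hypothesis Hdec : ritz_decomposition c H Xw lw Xu lu.

Lemma rho_quad_split (e : seq (R[i] * R[i])) :
  {in e, forall zw, zw.1%:M - H \in unitmx} ->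
  rho_quad e H = Xw *m rho_quad e (diag_mx lw) *m Xw^t* +
                 Xu *m rho_quad e (diag_mx lu) *m Xu^t*.
Proof.
have [[XX fX] HE _ _] := Hdec; move=> ue.
rewrite /rho_quad -!quad_mul -quadD; apply: eq_quad => zw /ue.
by move=> /(resolvent_unit XX HE)[uw uu]; exact: resolvent_split.
Qed.

Lemma trace_resolvent_split z : trace c z ->
  invmx (z%:M - H) = Xw *m invmx (z%:M - diag_mx lw) *m Xw^t* +
                     Xu *m invmx (z%:M - diag_mx lu) *m Xu^t*.
Proof.
have [[XX fX] HE lin lout] := Hdec; move=> tz.
apply: resolvent_split => //; rewrite unit_diag_sub; apply/forallP => j;
  apply: trace_sub_neq0 tz.
  by have [] := lin j.
by have [] := lout j.
Qed.

(** The pieces are integrable because the Ritz values avoid the contour. *)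
Lemma ointegrable_resolvent_split :
  ointegrable c (fun z => Xw *m invmx (z%:M - diag_mx lw) *m Xw^t*) /\
  ointegrable c (fun z => Xu *m invmx (z%:M - diag_mx lu) *m Xu^t*).
Proof.
have [_ _ lin lout] := Hdec.
split; apply: ointegrable_mulr; apply: ointegrable_mull;
  apply: ointegrable_resolvent_diag => j.
  by have [] := lin j.
by have [] := lout j.
Qed.

Lemma ointegrable_resolvent : ointegrable c (fun z => invmx (z%:M - H)).
Proof.
have [iw iu] := ointegrable_resolvent_split.
apply: eq_ointegrable (ointegrableD iw iu) => z tz.
by rewrite trace_resolvent_split.
Qed.

Lemma rho_split :
  rho c H = Xw *m rho c (diag_mx lw) *m Xw^t* + Xu *m rho c (diag_mx lu) *m Xu^t*.
Proof.
have [iw iu] := ointegrable_resolvent_split.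
have [_ _ lin lout] := Hdec.
have dw : ointegrable c (fun z => invmx (z%:M - diag_mx lw)).
  by apply: ointegrable_resolvent_diag => j; have [] := lin j.
have du : ointegrable c (fun z => invmx (z%:M - diag_mx lu)).
  by apply: ointegrable_resolvent_diag => j; have [] := lout j.
rewrite /rho (eq_oint trace_resolvent_split) ointD// scalerDr.
rewrite !oint_mulr ?oint_mull//; try exact: ointegrable_mull.
by rewrite -!scalemxAr -!scalemxAl.
Qed.

End Filters.

(** * FEAST iterates and Arnoldi restarts *)

Section Restart.
Variables (R : realType) (n k m0 : nat) (c : closed_contour R).
Variables (A : 'M[R[i]]_n) (V : 'M[R[i]]_(n, k * m0)).
Hypothesis VV : V^t* *m V = 1%:M.
Let H := V^t* *m A *m V.
Variables (Xw : 'M[R[i]]_(k * m0, m0)) (lw : 'rV[R[i]]_m0).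
Variables (Xu : 'M[R[i]]_(k * m0, k.-1 * m0)) (lu : 'rV[R[i]]_(k.-1 * m0)).
Hypothesis Hdec : ritz_decomposition c H Xw lw Xu lu.

Lemma orthonormal_lift (p q : nat) (X : 'M[R[i]]_(k * m0, p)) (Y : 'M[R[i]]_(k * m0, q)) :
  (V *m X)^t* *m (V *m Y) = X^t* *m Y.
Proof. by rewrite adjmxM -mulmxA (mulmxA (V^t*)) VV mul1mx. Qed.

Lemma filter_components (X0 : 'M[R[i]]_(n, m0)) (W Tw : 'M[R[i]]_m0)
    (U : 'M[R[i]]_(k.-1 * m0, m0)) (Tu : 'M[R[i]]_(k.-1 * m0)) :
  X0 = V *m Xw *m W + V *m Xu *m U ->
  V *m (Xw *m Tw *m Xw^t* + Xu *m Tu *m Xu^t*) *m V^t* *m X0 =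
  V *m (Xw *m Tw *m W + Xu *m Tu *m U).
Proof.
have [[XX fX] _ _ _] := Hdec; have [ww wu uw uu] := ritz_orthonormal XX.
move=> ->; rewrite -!mulmxA; congr (V *m _).
rewrite mulmxDr !(mulmxA (V^t*)) VV !mul1mx mulmxDl -!mulmxA !mulmxDr.
rewrite !(mulmxA (Xw^t*)) !(mulmxA (Xu^t*)) ww wu uw uu !mul0mx !mul1mx.
by rewrite !mulmx0 addr0 add0r.
Qed.

Lemma reduced_problem (W : 'M[R[i]]_m0) :
  let Q := V *m Xw *m W in
  Q^t* *m A *m Q = W^t* *m diag_mx lw *m W /\ Q^t* *m Q = W^t* *m W.
Proof.
have [[XX fX] HE _ _] := Hdec; have [ww _ _ _] := ritz_orthonormal XX.
move=> Q; split; rewrite /Q; last first.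
  by rewrite -mulmxA orthonormal_lift adjmxM -mulmxA (mulmxA (Xw^t*)) ww mul1mx.
rewrite !adjmxM -!mulmxA (mulmxA A) (mulmxA (V^t*)) (mulmxA (V^t*)) -/H.
by rewrite (mulmxA H) (ritz_vectorsw XX HE) -mulmxA (mulmxA (Xw^t*)) ww mul1mx.
Qed.

(** The choice X_Q = W^-1 P works: it cancels the factor W of Q = V Xw W. *)
Lemma feast_of_rotation (W P : 'M[R[i]]_m0) (th : 'rV[R[i]]_m0) :
  W \in unitmx -> P^t* *m P = 1%:M -> diag_mx lw *m P = P *m diag_mx th ->
  feast_iterate A (V *m Xw *m W) (V *m (Xw *m P)) th.
Proof.
move=> uW PP lP; have [e1 e2] := reduced_problem W; rewrite /feast_iterate e1 e2.
have [X WX] : exists X, W *m X = P by exists (invmx W *m P); rewrite mulKVmx.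
exists X; split.
- by rewrite -!(mulmxA _ W X) WX -(mulmxA _ _ P) lP mulmxA.
- by rewrite (mulmxA (X^t*)) -adjmxM -(mulmxA _ W X) WX.
- by rewrite -(mulmxA _ W X) WX mulmxA.
Qed.

(** The rotation is P = W X_Q: it is unitary by the normalization of X_Q, so W is
    invertible and W^H cancels from the reduced equation. *)
Lemma feast_rotation (W : 'M[R[i]]_m0) (X1 : 'M[R[i]]_(n, m0)) (th : 'rV[R[i]]_m0) :
  feast_iterate A (V *m Xw *m W) X1 th ->
  exists P : 'M[R[i]]_m0, [/\ P^t* *m P = 1%:M,
    diag_mx lw *m P = P *m diag_mx th & X1 = V *m (Xw *m P)].
Proof.
have [e1 e2] := reduced_problem W; move=> [XQ []]; rewrite e1 e2 => eig nrm ->.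
have PP : (W *m XQ)^t* *m (W *m XQ) = 1%:M by rewrite -nrm adjmxM !mulmxA.
have [_ uP] := mulmx1_unit PP.
have uW : W^t* \in unitmx.
  by rewrite map_unitmx unitmx_tr; move: uP; rewrite unitmx_mul => /andP[].
exists (W *m XQ); split; [exact: PP| |by rewrite !mulmxA].
by apply: (can_inj (mulKmx uW)); move: eig; rewrite !mulmxA.
Qed.

(** Since P diagonalizes Lw, each entry of th is an entry of lw, hence inside the contour;
    the unwanted Ritz vectors are left alone. *)
Lemma restart_of_rotation (P : 'M[R[i]]_m0) (th : 'rV[R[i]]_m0) :
  P^t* *m P = 1%:M -> diag_mx lw *m P = P *m diag_mx th ->
  arnoldi_restart c A V (V *m (Xw *m P)) th.
Proof.
have [[XX fX] HE lin lout] := Hdec; have [ww wu uw uu] := ritz_orthonormal XX.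
move=> PP lP; have PP' := mulmx1C PP; have [_ uP] := mulmx1_unit PP.
exists (Xw *m P), Xu, lu; split; last first.
  by rewrite -mulmxA mul_row_col mulmx1 mulmx0 addr0.
split; [split| | |exact: lout].
- rewrite tr_row_mx map_col_mx mul_col_row scalar_mx_block !adjmxM.
  rewrite -!mulmxA !(mulmxA (Xw^t*)) (mulmxA (Xu^t*)) ww wu uw uu.
  by rewrite mul1mx mul0mx mulmx0 PP.
- rewrite tr_row_mx map_col_mx mul_row_col adjmxM mulmxA -(mulmxA Xw) PP' mulmx1.
  exact: (ritz_complete fX).
- rewrite mul_row_block !mulmx0 addr0 add0r tr_row_mx map_col_mx mul_row_col.
  rewrite adjmxM mulmxA -!(mulmxA Xw) -lP -!mulmxA (mulmxA P) PP' mul1mx.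
  by rewrite !mulmxA; exact: (ritz_spectral HE).
- by move=> j; have [i ->] := diag_similar_eigen uP lP j; exact: lin.
Qed.

(** Two orthonormal bases of wanted Ritz vectors span the same space: inside and outside
    points of the contour differ, so ritz_vectors_unique applies. *)
Lemma restart_rotation (X1 : 'M[R[i]]_(n, m0)) (th : 'rV[R[i]]_m0) :
  arnoldi_restart c A V X1 th ->
  exists P : 'M[R[i]]_m0, [/\ P^t* *m P = 1%:M,
    diag_mx lw *m P = P *m diag_mx th & X1 = V *m (Xw *m P)].
Proof.
have [[XX fX] HE lin lout] := Hdec; have [ww _ _ _] := ritz_orthonormal XX.
move=> [Yw [Yu [mu [ [ [XX' fX'] HE' thin _] ->]]]].
have [yy _ _ _] := ritz_orthonormal XX'.
have HY := ritz_vectorsw XX' HE'.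
have sep i j : lu 0 i != th 0 j.
  apply/eqP => e; have [_ nb] := lout i; have [_ b] := thin j.
  by apply: nb; rewrite e.
have [P YE] : exists P, Yw = Xw *m P.
  by exists (Xw^t* *m Yw); exact: ritz_vectors_unique XX fX HE _ _ HY sep.
exists P; split.
- have := yy; rewrite YE adjmxM -mulmxA (mulmxA (Xw^t*)) ww mul1mx; exact.
- have := congr1 (mulmx (Xw^t*)) HY.
  by rewrite YE (mulmxA _ Xw) (ritz_vectorsw XX HE) !mulmxA ww !mul1mx.
- by rewrite -YE -mulmxA mul_row_col mulmx1 mulmx0 addr0.
Qed.

End Restart.

Theorem mainTheorem3 (R : realType) (n m0 k : nat) (k_gt0 : (0 < k)%N)
    (A : 'M[R[i]]_n) (A_herm : A \is hermsymmx)
    (X0 : 'M[R[i]]_(n, m0))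
    (V : 'M[R[i]]_(n, k * m0)) (V_arnoldi : block_arnoldi A X0 V)
    (c : closed_contour R) (c_pos : positively_oriented c)
    (Xw : 'M[R[i]]_(k * m0, m0)) (lw : 'rV[R[i]]_m0)
    (Xu : 'M[R[i]]_(k * m0, k.-1 * m0)) (lu : 'rV[R[i]]_(k.-1 * m0)) :
  let H := V^t* *m A *m V in
  let XV := row_mx Xw Xu in
  let Lw := diag_mx lw in
  let Lu := diag_mx lu in
  let Y := fom A V X0 in
  let Q := (twopii R)^-1 *: oint c Y in
  ritz_decomposition c H Xw lw Xu lu ->
  block_hessenberg H /\
  (forall z : R[i], Y z = V *m invmx (z%:M - H) *m V^t* *m X0) /\
  (exists (W : 'M[R[i]]_m0) (U : 'M[R[i]]_(k.-1 * m0, m0)),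
     X0 = V *m Xw *m W + V *m Xu *m U) /\
  (forall (W : 'M[R[i]]_m0) (U : 'M[R[i]]_(k.-1 * m0, m0)),
     X0 = V *m Xw *m W + V *m Xu *m U ->
     (* the integral evaluated by a quadrature rule *)
     (forall s : seq (R[i] * R[i]),
        {in s, forall zw, zw.1%:M - H \in unitmx} ->
        let Qs := quad s Y in
        [/\ Qs = V *m quad s (fun z => invmx (z%:M - H)) *m V^t* *m X0,
            Qs = V *m rho_quad s H *m V^t* *m X0,
            Qs = V *m (Xw *m rho_quad s Lw *m W + Xu *m rho_quad s Lu *m U)
          & forall eps : R,
              (forall i, `|rho_quad s Lw i i - 1| <= (eps%:C)%C) ->
              (forall i, `|rho_quad s Lu i i| <= (eps%:C)%C) ->
              (forall i j, `|((V *m Xw)^t* *m Qs) i j - W i j|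
                             <= (eps%:C)%C * `|W i j|) /\
              (forall i j, `|((V *m Xu)^t* *m Qs) i j|
                             <= (eps%:C)%C * `|U i j|)]) /\
     (* the integral evaluated exactly *)
     [/\ Q = V *m ((twopii R)^-1 *: oint c (fun z => invmx (z%:M - H)))
               *m V^t* *m X0,
         Q = V *m rho c H *m V^t* *m X0
       & Q = V *m (Xw *m rho c Lw *m W + Xu *m rho c Lu *m U)] /\
     [/\ rho c Lw = 1%:M, rho c Lu = 0 & Q = V *m Xw *m W] /\
     (Q^t* *m A *m Q = W^t* *m Lw *m W /\ Q^t* *m Q = W^t* *m W)) /\
  V *m Xw = V *m XV *m col_mx 1%:M 0 /\
  (Q^t* *m Q \in unitmx -> feast_iterate A Q (V *m Xw) lw) /\
  (forall X1 th, feast_iterate A Q X1 th -> arnoldi_restart c A V X1 th) /\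
  (Q^t* *m Q \in unitmx ->
     forall X1 th, arnoldi_restart c A V X1 th -> feast_iterate A Q X1 th).
Proof.
move=> H XV Lw Lu Y Q dec; have [VV _ _ _] := V_arnoldi.
have [[XX fX] HE lin lout] := dec.
have [ww wu uw uu] := ritz_orthonormal XX.
have YE z : Y z = V *m invmx (z%:M - H) *m V^t* *m X0 := fom_resolvent V_arnoldi z.
have YF : Y = fun z => V *m invmx (z%:M - H) *m (V^t* *m X0).
  by apply/funext => z; rewrite YE mulmxA.
have rw : rho c Lw = 1%:M by exact: rho_inside.
have ru : rho c Lu = 0 by exact: rho_outside.
have QE : Q = V *m rho c H *m V^t* *m X0.
  have iH := ointegrable_resolvent dec.
  rewrite /Q YF oint_mulr ?oint_mull//;
    last exact: ointegrable_mull.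
  by rewrite /rho -scalemxAr -!scalemxAl !mulmxA.
have X0E : exists (W : 'M[R[i]]_m0) (U : 'M[R[i]]_(k.-1 * m0, m0)),
    X0 = V *m Xw *m W + V *m Xu *m U.
  exists (Xw^t* *m V^t* *m X0), (Xu^t* *m V^t* *m X0).
  rewrite -!mulmxA -mulmxDr !(mulmxA Xw) !(mulmxA Xu) -mulmxDl (ritz_complete fX).
  by rewrite mul1mx (arnoldi_start V_arnoldi).
have QW W U : X0 = V *m Xw *m W + V *m Xu *m U -> Q = V *m Xw *m W.
  move=> XE; rewrite QE (rho_split dec) (filter_components VV dec _ _ XE) rw ru.
  by rewrite mulmx1 mulmx0 mul0mx addr0 mulmxA.
split; first exact: arnoldi_hessenberg V_arnoldi.
split; first exact: YE.
split; first exact: X0E.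
split.
  move=> W U XE; split.
    move=> s us Qs.
    have QsE : Qs = V *m rho_quad s H *m V^t* *m X0.
      by rewrite /Qs YF (quad_mul s V (fun z => invmx (z%:M - H))) mulmxA.
    have QsE' := QsE.
    rewrite (rho_quad_split dec us) (filter_components VV dec _ _ XE) in QsE'.
    split => // eps ew eu.
    have us' : {in s, forall zw, zw.1%:M - Lw \in unitmx} /\
               {in s, forall zw, zw.1%:M - Lu \in unitmx}.
      by split=> zw /us /(resolvent_unit XX HE)[].
    rewrite QsE' !orthonormal_lift// !mulmxDr !mulmxA ww wu uw uu.
    rewrite !mul0mx addr0 add0r !mul1mx.
    move: ew eu; rewrite (rho_quad_diag us'.1) (rho_quad_diag us'.2).
    set dw := \row_j _; set du := \row_j _ => ew eu.
    split=> i j; rewrite mul_diag_mx !mxE.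
      have := ew i; rewrite !mxE eqxx => ewi.
      by rewrite -[X in _ - X]mul1r -mulrBl normrM ler_wpM2r.
    have := eu i; rewrite !mxE eqxx => eui.
    by rewrite normrM ler_wpM2r.
  split.
    split=> //.
    by rewrite QE (rho_split dec) (filter_components VV dec _ _ XE).
  split; first by split=> //; exact: QW XE.
  by rewrite (QW _ _ XE); exact: (reduced_problem VV dec).
have [W [U XE]] := X0E; have QWE := QW _ _ XE.
have uW : Q^t* *m Q \in unitmx -> W \in unitmx.
  by rewrite QWE (reduced_problem VV dec W).2; exact: unitmx_gram.
split; first by rewrite -mulmxA mul_row_col mulmx1 mulmx0 addr0.
split; [|split].
- move=> /uW {}uW; have := feast_of_rotation VV dec (P := 1%:M) (th := lw) uW.
  by rewrite trmx1 map_mx1 !mulmx1 mul1mx QWE; apply.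
- move=> X1 th; rewrite QWE => /(feast_rotation VV dec)[P [PP lP ->]].
  exact: (restart_of_rotation dec PP lP).
- move=> /uW {}uW X1 th /(restart_rotation dec)[P [PP lP ->]].
  by rewrite QWE; exact: (feast_of_rotation VV dec uW PP lP).
Qed.
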